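(* Let $\mathcal{H}\neq\{0\}$ be a separable complex Hilbert space with unit sphere $S$. The mapping $F: S/S^1\to\partial_e\mathcal{S}(\mathcal{H})$, $F([\varphi]_S):=P_\varphi=|\varphi\rangle\langle\varphi|$ where $\varphi\in S$, is a homeomorphism between the topological spaces $(S/S^1,\mathcal{T}_\nu)$ and $(\partial_e\mathcal{S}(\mathcal{H}),\mathcal{T}_0)$.
   Context: $S:=\{\varphi\in\mathcal{H}\mid\|\varphi\|=1\}$ carries the topology induced by the norm of $\mathcal{H}$. $S/S^1$ is the set of equivalence classes $[\varphi]_S$ of unit vectors $\varphi\in S$, two unit vectors being equivalent iff they differ by a phase factor $\lambda\in S^1=\{\lambda\in\mathbb{C}\mid|\lambda|=1\}$. $\mathcal{T}_\nu$ is the quotient topology on $S/S^1$ for the canonical projection $\nu:S\to S/S^1$, $\nu(\varphi)=[\varphi]_S$, i.e. $O\subseteq S/S^1$ is open iff $\nu^{-1}(O)$ is open in $S$. $\partial_e\mathcal{S}(\mathcal{H})$ is the set of one-dimensional orthogonal projections on $\mathcal{H}$ (the extreme points of the convex set of density operators), and $\mathcal{T}_0$ is the coarsest topology on it such that all functions $h_Q(P):=\mathrm{tr}\,PQ$, $Q\in\partial_e\mathcal{S}(\mathcal{H})$, are continuous. *)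

(* Defs.v *)
From HB Require Import structures.
From mathcomp Require Import all_boot all_order all_algebra.
From mathcomp Require Import finmap complex.
From mathcomp Require Import all_classical all_reals all_analysis.
From mathcomp Require Import summability.

Set Implicit Arguments.
Unset Strict Implicit.
Unset Printing Implicit Defensive.

Import Order.TTheory GRing.Theory Num.Theory.
Import numFieldNormedType.Exports.

Local Open Scope classical_set_scope.
Local Open Scope ring_scope.
Local Open Scope complex_scope.
Local Open Scope quotient_scope.

Definition separable (T : topologicalType) : Prop :=
  exists2 D : set T, countable D & dense D.

Definition homeomorphism (T U : topologicalType) (f : T -> U) : Prop :=
  exists g : U -> T,
    [/\ cancel f g, cancel g f, continuous f & continuous g].

(* A complex Hilbert space is a complete normed module H over R[i] with an inner
   product inducing its norm.  The forms in {dot H for Num.conj} are linear in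
   their FIRST argument and conjugate-linear in the second one, so the physicists'
   <phi|psi> is dot psi phi. *)
Definition hilbert_norm (R : realType) (H : completeNormedModType R[i])
  (dot : {dot H for (@Num.conj R[i])}) : Prop :=
  forall x : H, `|x| ^+ 2 = dot x x.

Section Sphere.
Context (R : realType) (H : completeNormedModType R[i]).

(* the library endows set_type with the subspace topology *)
Definition sphere : topologicalType := set_type [set x : H | `|x| = 1].

Definition phase_rel (x y : sphere) : bool :=
  `[< exists2 l : R[i], `|l| = 1 & set_val x = l *: set_val y >].

Lemma phase_rel_refl : reflexive phase_rel.
Proof. by move=> x; apply/asboolP; exists 1; rewrite ?normr1 ?scale1r. Qed.

Lemma phase_rel_sym : symmetric phase_rel.
Proof.
have sub x y : phase_rel x y -> phase_rel y x.
  move=> /asboolP[l l1 xly]; apply/asboolP.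
  exists l^-1; first by rewrite normfV l1 invr1.
  by rewrite xly scalerA mulVf ?scale1r// -normr_eq0 l1 oner_eq0.
by move=> x y; apply/idP/idP; exact: sub.
Qed.

Lemma phase_rel_trans : transitive phase_rel.
Proof.
move=> y x z /asboolP[l l1 xly] /asboolP[m m1 ymz]; apply/asboolP.
by exists (l * m); rewrite ?normrM ?l1 ?m1 ?mul1r// xly ymz scalerA.
Qed.

Canonical phase_equiv :=
  EquivRel phase_rel phase_rel_refl phase_rel_sym phase_rel_trans.

(* the projective space S / S^1 *)
Definition rays : topologicalType := quotient_topology {eq_quot phase_equiv}.

Definition ray (x : sphere) : rays := \pi_({eq_quot phase_equiv})%qT x.

End Sphere.

Section States.
Context (R : realType) (H : completeNormedModType R[i]).
Variable dot : {dot H for (@Num.conj R[i])}.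

Definition orthonormal_set (E : set H) : Prop :=
  forall x y, E x -> E y -> dot x y = (x == y)%:R.

Definition orthonormal_basis (E : set H) : Prop :=
  orthonormal_set E /\
  forall E', orthonormal_set E' -> E `<=` E' -> E' = E.

(* t is the sum of the <e|A e> over every orthonormal basis, the sums being
   unconditional, i.e. limits along the net of the finite subsets of the basis;
   for a trace-class A this determines t. *)
Definition is_trace (A : H -> H) (t : R[i]^o) : Prop :=
  forall E : set H, orthonormal_basis E ->
    partial_sum (fun e : E => dot (A (set_val e)) (set_val e) : R[i]^o)
      @ totally --> t.

(* 0 on operators without a trace *)
Definition tr (A : H -> H) : R[i]^o := xget 0 [set t | is_trace A t].

Definition orthogonal_projection (P : H -> H) : Prop :=
  [/\ linear P, continuous P, P \o P = P
    & forall x y, dot (P x) y = dot x (P y)].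

Definition one_dimensional_range (P : H -> H) : Prop :=
  exists2 v : H, v != 0 & range P = [set c *: v | c in [set: R[i]]].

Definition pure_set : set (H -> H) :=
  [set P | orthogonal_projection P /\ one_dimensional_range P].

Definition op_of (P : set_type pure_set) : H -> H := set_val P.

Definition transition (Q P : set_type pure_set) : R[i]^o :=
  tr (op_of P \o op_of Q).

(* The coarsest topology making every P |-> tr (P Q) continuous, obtained as the
   supremum of the initial topologies of these maps. *)
Definition pure_states : topologicalType :=
  sup_topology (fun Q : set_type pure_set =>
    Topological.class (initial_topology (transition Q))).

(* |phi><phi| *)
Definition ketbra (phi : H) : H -> H := fun x => dot x phi *: phi.

End States.

(* Main.v *)
(** The trace of P_psi P_phi is evaluated in an arbitrary maximal orthonormal
    set E: by Bessel the finite partial sums of the Fourier expansion of a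
    vector form a Cauchy net, by maximality of E its limit is that vector, and
    hence the trace is |<psi|phi>|^2 (a maximal E exists by Zorn, so the trace
    is unambiguous).  Continuity of F is then that of phi |-> |<phi|chi>|^2 on
    the sphere.  For the inverse, choosing the phase of psi so that
    <psi|phi> = t >= 0 gives
    |phi - psi|^2 = 2 - 2t <= 2(1 - t^2) = 2(1 - tr (P_phi P_psi)), so the
    single function h_(P_phi) controls the distance of the rays near phi. *)
Require Import Defs.
From HB Require Import structures.
From mathcomp Require Import all_boot all_order all_algebra.
From mathcomp Require Import finmap complex.
From mathcomp Require Import all_classical all_reals all_analysis.
From mathcomp Require Import summability.

Import Order.TTheory GRing.Theory Num.Theory.
Import numFieldNormedType.Exports.

Local Open Scope classical_set_scope.
Local Open Scope ring_scope.
Local Open Scope complex_scope.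

#[local] Existing Instance totally_filter.

Section Hilbert.
Context {R : realType} {H : completeNormedModType R[i]}.
Context {dot : {dot H for (@Num.conj R[i])}} (dotE : hilbert_norm dot).

(** * Inner product: Cauchy-Schwarz and continuity *)

Lemma dot_conj (u v : H) : dot u v = (dot v u)^*%R.
Proof. by rewrite hermC mul1r. Qed.

Lemma dotZl (a : R[i]) (u v : H) : dot (a *: u) v = a * dot u v.
Proof. by rewrite linearZl_LR. Qed.

Lemma dotZr (a : R[i]) (u v : H) : dot u (a *: v) = a^*%R * dot u v.
Proof. by rewrite linearZr_LR. Qed.

Lemma norm_dot_mul (u v : H) : dot u v * dot v u = `|dot u v| ^+ 2.
Proof. by rewrite (dot_conj v u) normCK. Qed.

(** Pythagoras for [u = w + a *: v], where [a *: v] is the orthogonal projection of [u] on the line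
    of [v]. *)
Lemma CauchySchwarz (u v : H) : `|dot u v| <= `|u| * `|v|.
Proof.
have [->|v0] := eqVneq v 0; first by rewrite linear0r !normr0 mulr0.
have vv0 : dot v v != 0 by rewrite -dotE expf_neq0 ?normr_eq0.
pose a := dot u v / dot v v; pose w := u - a *: v.
have wv : dot w (a *: v) = 0.
  by rewrite dotZr linearBl/= dotZl divfK// subrr mulr0.
have uE : u = w + a *: v by rewrite subrK.
rewrite -(@ler_pXn2r _ 2) ?nnegrE ?mulr_ge0//.
have : `|a *: v| ^+ 2 <= `|u| ^+ 2.
  by rewrite !dotE [in leRHS]uE hnormDd// lerDr; exact: dnorm_ge0.
rewrite normrZ !exprMn => /(ler_wpM2r (exprn_ge0 2 (normr_ge0 v))).
apply: le_trans.
rewrite -[dot u v](divfK vv0) -/a -dotE normrM normrX normr_id.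
by rewrite exprMn (expr2 (_ ^+ 2)) mulrA.
Qed.

Lemma dot_continuous (v : H) : continuous (dot^~ v : H -> R[i]^o).
Proof.
move=> x; apply/cvgrPdist_le => e e0.
(* Adding 1 keeps the divisor positive when [v = 0]. *)
have v1 : 0 < `|v| + 1 by rewrite ltr_wpDl.
near=> y.
rewrite -linearBl/= (le_trans (CauchySchwarz _ _))//.
have : `|x - y| <= e / (`|v| + 1).
  near: y; have /cvgrPdist_le := @cvg_id _ (nbhs x).
  by apply; exact: divr_gt0.
rewrite ler_pdivlMr//; apply: le_trans.
by rewrite ler_wpM2l// lerDl.
Unshelve. all: by end_near. Qed.

Lemma dot_norm2_continuous (v : H) :
  continuous (fun x => `|dot x v| ^+ 2 : R[i]^o).
Proof.
move=> x; have dv : `|dot y v| @[y --> x] --> (`|dot x v| : R[i]^o).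
  exact: (cvg_norm (dot_continuous v x)).
exact: (cvgM dv dv).
Qed.

(** * Unit vectors and maximal orthonormal sets *)

Lemma norm_unit (phi : sphere H) : `|set_val phi| = 1.
Proof. exact: (set_valP phi). Qed.

Lemma dot_unit (phi : sphere H) : dot (set_val phi) (set_val phi) = 1.
Proof. by rewrite -dotE norm_unit expr1n. Qed.

(** Zorn applies because any two vectors in the union of a chain already lie in one member of it. *)
Lemma orthonormal_basis_exists : exists E, orthonormal_basis dot E.
Proof.
have [|E [oE maxE]] := @Zorn_bigcup H (orthonormal_set dot).
  move=> F Fo Ftot x y [X FX Xx] [Y FY Yy].
  have [XY|YX] := Ftot _ _ FX FY.
    by apply: (Fo _ FY) => //; exact: XY.
  by apply: (Fo _ FX) => //; exact: YX.
exists E; split=> // E' oE' EE'; apply: contrapT => E'E.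
apply: (maxE E') => //; split=> // E'sE; apply: E'E.
by apply/seteqP; split.
Qed.

(** If [z] were nonzero, its normalisation [u] could be added to [E], against maximality. *)
Lemma orthogonal_basis_eq0 (E : set H) (z : H) : orthonormal_basis dot E ->
  (forall e, E e -> dot z e = 0) -> z = 0.
Proof.
move=> [oE maxE] zE; apply/eqP/negPn/negP => z0.
have nz0 : `|z| != 0 by rewrite normr_eq0.
pose u := `|z|^-1 *: z.
have uu : dot u u = 1.
  by rewrite -dotE normrZ normfV normr_id mulVf// expr1n.
have uE e : E e -> dot u e = 0 by move=> Ee; rewrite dotZl zE// mulr0.
have E'E : E `|` [set u] = E.
  apply: maxE => // x y [Ex|->] [Ey|->].
  - exact: oE.
  - rewrite dot_conj uE// rmorph0; case: eqP => // xu.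
    by move: (uE _ Ex); rewrite xu uu => /eqP; rewrite oner_eq0.
  - rewrite uE//; case: eqP => // xu.
    by move: (uE _ Ey); rewrite -xu uu => /eqP; rewrite oner_eq0.
  - by rewrite uu eqxx.
have Eu : E u by rewrite -E'E; right.
by move: (uE _ Eu); rewrite uu => /eqP; rewrite oner_eq0.
Qed.

(** * Fourier expansions along an orthonormal set *)

Lemma partial_sumE (I : choiceType) (V : zmodType) (f : I -> V) (J : {fset I}) :
  partial_sum f J = \sum_(i <- J) f i.
Proof. by rewrite /partial_sum big_seq_fsetE. Qed.

Section Fourier.
Context (E : set H) (oE : orthonormal_set dot E) (x : H).

Let term (e : E) : H := dot x (set_val e) *: set_val e.
Let energy (J : {fset E}) : R[i] := \sum_(e <- J) `|dot x (set_val e)| ^+ 2.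

Lemma dot_fourier (J : {fset E}) (e : E) :
  dot (partial_sum term J) (set_val e) =
  if e \in J then dot x (set_val e) else 0.
Proof.
have dterm (i : E) :
    dot (term i) (set_val e) = dot x (set_val i) * (i == e)%:R.
  by rewrite dotZl (oE _ _ (set_valP i) (set_valP e)) -val_eqE.
rewrite partial_sumE linear_sumlz/=.
under eq_bigr do rewrite dterm.
case: ifPn => eJ.
  rewrite (big_fsetD1 e)//= eqxx mulr1 big_seq big1 ?addr0// => i.
  by rewrite !inE => /andP[/negbTE-> _]; rewrite mulr0.
rewrite big_seq big1// => i iJ; case: eqP => [ie|]; last by rewrite mulr0.
by rewrite -ie iJ in eJ.
Qed.

Lemma dot_fourier_r (J : {fset E}) : dot x (partial_sum term J) = energy J.
Proof.
rewrite partial_sumE linear_sumr/=; apply: eq_bigr => e _.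
by rewrite dotZr mulrC normCK.
Qed.

Lemma norm_fourier (J : {fset E}) : `|partial_sum term J| ^+ 2 = energy J.
Proof.
rewrite dotE [X in dot _ X]partial_sumE linear_sumr/= /energy.
rewrite [LHS]big_seq [RHS]big_seq; apply: eq_bigr => e eJ.
by rewrite dotZr dot_fourier eJ mulrC normCK.
Qed.

(** Expand the squared norm of [x - s] for the partial sum [s]: the cross products and the square of
    [s] all equal [energy J]. *)
Lemma bessel (J : {fset E}) : energy J <= `|x| ^+ 2.
Proof.
have := dnorm_ge0 dot (x - partial_sum term J).
rewrite dnormB -!dotE norm_fourier dot_fourier_r.
have eR : (energy J)^*%R = energy J.
  by rewrite conj_Creal// -norm_fourier rpredX// normr_real.
by rewrite eR opprD addrA addrK subr_ge0.
Qed.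

(** Up to sign the difference is the partial sum over the indices in [K] but not in [J], to which
    [norm_fourier] applies. *)
Lemma fourier_dist (J K : {fset E}) : (J `<=` K)%fset ->
  `|partial_sum term J - partial_sum term K| ^+ 2 = energy K - energy J.
Proof.
move=> JK.
have sumD (V : zmodType) (f : E -> V) : \sum_(e <- K) f e =
    \sum_(e <- J) f e + \sum_(e <- (K `\` J)%fset) f e.
  rewrite (big_fsetID _ (mem J))/=; congr (_ + _).
    by apply: eq_fbigl => e; rewrite !inE/= andbC; apply/andb_idr/fsubsetP.
  by apply: eq_fbigl => e; rewrite !inE/= andbC.
have -> : energy K = energy J + energy (K `\` J)%fset by exact: sumD.
rewrite distrC !partial_sumE sumD ![_ + _ - _]addrAC !subrr !add0r.
by rewrite -norm_fourier partial_sumE.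
Qed.

Lemma fourier_cvg : cvg (partial_sum term @ totally).
Proof.
apply: cauchy_cvg; apply: cauchy_exP => eps eps0.
(* The energies are real, but the order of [R[i]] is only partial; taking real parts gives access to
   suprema in [R]. *)
pose A := [set complex.Re (energy J) | J in [set: {fset E}]].
have energyR J : (complex.Re (energy J))%:C = energy J.
  by apply: RRe_real; rewrite -norm_fourier rpredX// normr_real.
have supA : has_sup A.
  split; first by exists (complex.Re (energy fset0)), fset0.
  exists (complex.Re (`|x| ^+ 2)) => _ [J _ <-].
  by have := bessel J; rewrite lecE => /andP[].
have eps2 : 0 < complex.Re (eps ^+ 2).
  by have := exprn_gt0 2 eps0; rewrite ltcE => /andP[].
(* [J] nearly attains the supremum, so no larger [K] can add [eps ^+ 2] to its energy. *)
have [_ [J _ <-] supJ] := sup_adherent eps2 supA.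
exists (partial_sum term J); exists J => // K JK.
rewrite /= -ball_normE /ball_/= -(@ltr_pXn2r _ 2) ?nnegrE// ?ltW//.
rewrite fourier_dist// -(energyR K) -(energyR J) -rmorphB/=.
have -> : eps ^+ 2 = (complex.Re (eps ^+ 2))%:C.
  by rewrite RRe_real// rpredX// gtr0_real.
rewrite ltcR ltrBlDr; rewrite ltrBlDr addrC in supJ.
by apply: le_lt_trans supJ; apply: sup_upper_bound => //; exists K.
Qed.

End Fourier.

(** The limit [y] has the same coefficients as [x], so [x - y] is orthogonal to the basis and
    vanishes. *)
Lemma fourier_sum (E : set H) (x : H) : orthonormal_basis dot E ->
  partial_sum (fun e : E => dot x (set_val e) *: set_val e) @ totally --> x.
Proof.
move=> bE; have oE := bE.1.
have /cvg_ex[/= y Sy] := @fourier_cvg E oE x.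
suff xy : x = y by rewrite [X in _ --> X]xy.
apply/eqP; rewrite -subr_eq0; apply/eqP.
apply: (orthogonal_basis_eq0 _ _ bE) => e Ee.
rewrite linearBl/=; apply/eqP; rewrite subr_eq0; apply/eqP.
have Ay : (dot^~ e \o partial_sum (fun e : E => dot x (set_val e) *: set_val e))
    @ totally --> (dot y e : R[i]^o).
  by apply: cvg_comp Sy _; exact: dot_continuous.
have Ax : (dot^~ e \o partial_sum (fun e : E => dot x (set_val e) *: set_val e))
    @ totally --> (dot x e : R[i]^o).
  (* The coefficient at [e] no longer changes once the index set contains [e]. *)
  apply: cvg_near_cst; exists [fset (SigSub (mem_set Ee) : E)]%fset => // J eJ.
  have := @dot_fourier E oE x J (SigSub (mem_set Ee)).
  by rewrite (fsubsetP eJ) ?inE.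
exact: (cvg_unique (@norm_hausdorff _ R[i]^o) Ax Ay).
Qed.

(** * Traces of products of ket-bras *)

Lemma is_trace_ketbra (a b : H) :
  is_trace dot (ketbra dot a \o ketbra dot b) (`|dot a b| ^+ 2).
Proof.
(* Each diagonal term is the product of a Fourier term of [a] with the fixed vector [c], so the
   continuous map [dot^~ c] carries the expansion of [a] to the trace. *)
move=> E bE; pose c := (dot b a)^*%R *: b.
have -> : (fun e : E => dot ((ketbra dot a \o ketbra dot b) (set_val e))
    (set_val e) : R[i]^o) =
    (fun e : E => dot (dot a (set_val e) *: set_val e) c : R[i]^o).
  apply/funext => e; rewrite /ketbra/= !dotZl dotZr conjCK.
  by rewrite mulrC [_ * dot b a]mulrC.
have -> : partial_sum (fun e : E =>
    dot (dot a (set_val e) *: set_val e) c : R[i]^o) =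
    dot^~ c \o partial_sum (fun e : E => dot a (set_val e) *: set_val e).
  by apply/funext => J; rewrite /= !partial_sumE linear_sumlz.
have -> : `|dot a b| ^+ 2 = dot a c by rewrite dotZr conjCK mulrC norm_dot_mul.
apply: cvg_comp (fourier_sum _ a bE) _; exact: dot_continuous.
Qed.

Lemma tr_ketbra (a b : H) :
  tr dot (ketbra dot a \o ketbra dot b) = `|dot a b| ^+ 2.
Proof.
apply: xget_unique; first exact: is_trace_ketbra.
(* Without a basis every [t] would satisfy [is_trace] vacuously. *)
move=> t tt; have [E bE] := orthonormal_basis_exists.
have tab := is_trace_ketbra a b E bE.
exact: (cvg_unique (@norm_hausdorff _ R[i]^o) (tt E bE) tab).
Qed.

(** * Pure states as ket-bras of unit vectors, unique up to phase *)

Lemma ketbra_pure (phi : sphere H) : pure_set dot (ketbra dot (set_val phi)).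
Proof.
have pp := dot_unit phi; move: (set_val phi) pp => p pp; split.
- split.
  + by move=> a u v; rewrite /ketbra linearDl/= dotZl scalerDl scalerA.
  + move=> x; apply: cvgZr_tmp; exact: dot_continuous.
  + by apply/funext => x; rewrite /ketbra/= dotZl pp mulr1.
  + by move=> x y; rewrite /ketbra dotZl dotZr -dot_conj mulrC.
- exists p.
    by apply: contra_eq_neq pp => ->; rewrite linear0l eq_sym oner_eq0.
  apply/seteqP; split => [_ [x _ <-]|_ [c _ <-]]; first by exists (dot x p).
  by exists (c *: p) => //; rewrite /ketbra dotZl pp mulr1.
Qed.

(** For a unit vector [u] spanning the range, [P x = c *: u] and [P u = u]; self-adjointness then
    gives [c = dot (P x) u = dot x u]. *)
Lemma pure_ketbra (P : H -> H) : pure_set dot P ->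
  exists phi : sphere H, P = ketbra dot (set_val phi).
Proof.
move=> [[_ _ PP Psym] [v v0 rangeP]].
have nv0 : `|v| != 0 by rewrite normr_eq0.
have u1 : `| `|v|^-1 *: v| = 1 by rewrite normrZ normfV normr_id mulVf.
pose u : sphere H := SigSub (mem_set u1).
exists u; apply/funext => x.
have [c Px] : exists c, P x = c *: set_val u.
  have : range P (P x) by exists x.
  rewrite rangeP => -[c _ <-]; exists (c * `|v|).
  by rewrite -[set_val u]/(`|v|^-1 *: v) scalerA mulfK.
have Pu : P (set_val u) = set_val u.
  have : range P (set_val u) by rewrite rangeP; exists (`|v|^-1).
  by case=> y _ <-; exact: (congr1 (@^~ y) PP).
by rewrite /ketbra -[X in dot _ X]Pu -Psym Px dotZl dot_unit mulr1.
Qed.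

Lemma ketbra_phase (phi psi : sphere H) : phase_rel phi psi ->
  ketbra dot (set_val phi) = ketbra dot (set_val psi).
Proof.
move=> /asboolP[l l1 ->]; apply/funext => x.
rewrite /ketbra dotZr scalerA mulrC mulrA -normCK.
by rewrite l1 expr1n mul1r.
Qed.

(** Applying both operators to [phi] makes it a multiple of [psi], and comparing norms makes the
    coefficient a phase. *)
Lemma phase_ketbra (phi psi : sphere H) :
  ketbra dot (set_val phi) = ketbra dot (set_val psi) -> phase_rel phi psi.
Proof.
move=> E.
have phiE : set_val phi = dot (set_val phi) (set_val psi) *: set_val psi.
  have := congr1 (fun P => P (set_val phi)) E.
  by rewrite {1}/ketbra dot_unit scale1r.
apply/asboolP; exists (dot (set_val phi) (set_val psi)) => //.
by have := norm_unit phi; rewrite {1}phiE normrZ norm_unit mulr1.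
Qed.

Lemma ray_eqP (phi psi : sphere H) :
  reflect (ray phi = ray psi) (phase_rel phi psi).
Proof. exact: (@eqmodP _ (phase_equiv H) phi psi). Qed.

(** * Topology of the pure states and continuity of the ket-bra map *)

Lemma transition_continuous (Q : set_type (pure_set dot)) :
  continuous (transition Q : pure_states dot -> R[i]^o).
Proof.
move=> P; apply: cvg_trans; last first.
  exact: (@initial_continuous _ _ (transition Q) P).
apply: cvg_app.
exact: (@cvg_sup _ _ _ (nbhs (P : pure_states dot)) P _).1 cvg_id Q.
Qed.

Definition ketbra_state (phi : sphere H) : pure_states dot :=
  SigSub (mem_set (ketbra_pure phi)).

Lemma op_of_ketbra_state (phi : sphere H) :
  op_of (ketbra_state phi : set_type (pure_set dot)) = ketbra dot (set_val phi).
Proof. by []. Qed.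

Lemma ketbra_state_surj (P : pure_states dot) :
  exists phi, ketbra_state phi = P.
Proof.
have [phi Pphi] := pure_ketbra _ (set_valP (P : set_type (pure_set dot))).
by exists phi; apply/val_inj; rewrite /= -Pphi.
Qed.

Lemma ketbra_state_eqP (phi psi : sphere H) :
  ketbra_state phi = ketbra_state psi <-> ray phi = ray psi.
Proof.
split=> [E|/ray_eqP/ketbra_phase E]; last exact/val_inj.
by apply/ray_eqP/phase_ketbra; rewrite -!op_of_ketbra_state E.
Qed.

Lemma transition_ketbra (phi psi : sphere H) :
  transition (ketbra_state phi) (ketbra_state psi) =
  `|dot (set_val psi) (set_val phi)| ^+ 2.
Proof. exact: tr_ketbra. Qed.

(** Continuity into a supremum of initial topologies is tested on the composites with each
    [transition Q], and [Q] is itself the ket-bra of some [q]. *)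
Lemma ketbra_state_continuous : continuous ketbra_state.
Proof.
move=> phi; have FF : Filter (ketbra_state @ phi).
  by apply: fmap_filter; exact: nbhs_filter.
apply: ((@cvg_sup _ _ _ (ketbra_state @ phi) (ketbra_state phi) FF).2) => Q.
suff : continuous (ketbra_state : sphere H -> initial_topology (transition Q)).
  exact.
apply: continuous_comp_initial; have [q <-] := ketbra_state_surj Q.
have -> : transition (ketbra_state q) \o ketbra_state =
    (fun x => `|dot x (set_val q)| ^+ 2 : R[i]^o) \o set_val.
  by apply/funext => psi; exact: transition_ketbra.
move=> psi; apply: continuous_comp; first exact: initial_continuous.
exact: dot_norm2_continuous.
Qed.

(** * Distance between rays *)

Lemma phase_align (z : R[i]) : exists2 l : R[i], `|l| = 1 & l * z = `|z|.
Proof.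
have [->|z0] := eqVneq z 0; first by exists 1; rewrite ?normr1// mulr0 normr0.
have nz0 : `|z| != 0 by rewrite normr_eq0.
exists (z^*%R / `|z|).
  by rewrite normf_div norm_conjC normr_id divff.
by rewrite mulrAC [_ * z]mulrC -normCK expr2 mulfK.
Qed.

Lemma rotate_sphere (l : R[i]) (psi : sphere H) : `|l| = 1 ->
  `|l *: set_val psi| = 1.
Proof. by move=> l1; rewrite normrZ l1 mul1r norm_unit. Qed.

(** The outer modulus gives the bound the shape in which continuity of [transition] supplies its
    estimate in [R[i]]. *)
Lemma ray_dist (phi psi : sphere H) :
  exists2 chi : sphere H, ray chi = ray psi &
  `|set_val phi - set_val chi| ^+ 2 <=
    2 * `|1 - `|dot (set_val psi) (set_val phi)| ^+ 2|.
Proof.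
have [l l1 lE] := phase_align (dot (set_val psi) (set_val phi)).
exists (SigSub (mem_set (rotate_sphere l psi l1)) : sphere H).
  by apply/ray_eqP/asboolP; exists l.
move: lE; set t := `|dot _ _| => lE.
rewrite -[set_val (SigSub _)]/(l *: set_val psi).
have t0 : 0 <= t by exact: normr_ge0.
have t1 : t <= 1.
  by apply: (le_trans (CauchySchwarz _ _)); rewrite !norm_unit mulr1.
rewrite dotE dnormB -!dotE norm_unit rotate_sphere// dot_conj dotZl lE.
rewrite conjCK conj_Creal ?ger0_real// expr1n.
rewrite ger0_norm ?subr_ge0 ?expr_le1// mulrBr mulr1 -mulr2n -[t + t]mulr2n.
(* What remains is [t ^+ 2 <= t], from [0 <= t <= 1]. *)
by rewrite lerB// -[t *+ 2]mulr_natl ler_wpM2l// expr2 ler_piMl.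
Qed.

End Hilbert.

Theorem theorem5 (R : realType) (H : completeNormedModType R[i])
    (dot : {dot H for (@Num.conj R[i])})
    (dotE : hilbert_norm dot)
    (H_separable : separable H)
    (H_neq0 : exists x : H, x != 0) :
  exists F : rays H -> pure_states dot,
    (forall phi : sphere H, op_of (F (ray phi)) = ketbra dot (set_val phi)) /\
    homeomorphism F.
Proof.
(* [repr] picks a unit vector in each ray; [FE] shows that the choice does not affect the value. *)
pose F (r : rays H) : pure_states dot := ketbra_state dotE (repr r).
have rayK (r : rays H) : ray (repr r) = r by exact: reprK.
have FE phi : F (ray phi) = ketbra_state dotE phi.
  by apply/ketbra_state_eqP; exact: rayK.
have [g gK] := choice (ketbra_state_surj dotE).
exists F; split=> [phi|]; first by rewrite FE.
exists (fun P => ray (g P)); split.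
- by move=> r; rewrite -[RHS]rayK; apply/(ketbra_state_eqP dotE); exact: gK.
- by move=> P; rewrite FE gK.
- apply/quotient_continuous.
  rewrite (_ : F \o _ = ketbra_state dotE); last exact/funext.
  exact: ketbra_state_continuous.
move=> P U; rewrite nbhsE => -[V [oV VP] VU].
(* The preimage of [V] is open by the quotient topology, hence the trace on the sphere of an open
   [W] of [H]. *)
have [W oW WV] : open ((@ray R H) @^-1` V) by [].
have : nbhs (set_val (g P)) W.
  apply: open_nbhs_nbhs; split=> //.
  by rewrite -[W _]/((set_val @^-1` W) (g P)) WV.
rewrite -nbhs_ballE => -[/= e e0 eW].
(* [ray_dist] doubles this tolerance to [e ^+ 2 / 2], which leaves room for a strict inequality. *)
have d0 : 0 < e ^+ 2 / 2 / 2 by rewrite !divr_gt0// exprn_gt0.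
have /cvgrPdist_le/(_ _ d0) := @transition_continuous R H dot P P.
have tE Q Q' : transition Q Q' = `|dot (set_val (g Q')) (set_val (g Q))| ^+ 2.
  by rewrite -(transition_ketbra dotE) !gK.
apply: filterS => P'; rewrite !tE dot_unit// normr1 expr1n => dP'; apply: VU.
(* Replacing [g P'] by [chi] in the same ray brings it within [e] of [g P], hence into [W]. *)
have [chi chiE dchi] := ray_dist dotE (g P) (g P').
rewrite -[V _]/(V (ray (g P'))) -chiE.
rewrite -[V _]/((@ray R H @^-1` V) chi) -WV; apply: eW.
rewrite -ball_normE /ball_/= -(@ltr_pXn2r _ 2) ?nnegrE// ?ltW//.
apply: (le_lt_trans dchi).
apply: (@le_lt_trans _ _ (2 * (e ^+ 2 / 2 / 2))); first by rewrite ler_wpM2l.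
by rewrite mulrC divfK// ltr_pdivrMr// ltr_pMr ?exprn_gt0// ltr1n.
Qed.
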